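(* Let $(M,J,g)$ be a locally decomposable metallic Riemannian manifold with $J^2=pJ+qI$, $p,q\in\mathbb R$, $q\neq 0$, and let $D$ be a metallic semi-symmetric metric $J$-connection on $M$. Let $\hat J_m:=\begin{pmatrix} J & 0\\ 0& J^*\end{pmatrix}$ be the generalized metallic structure on $TM\oplus T^*M$ given by $\hat J_m(X+\alpha)=JX+J^*\alpha$. Then $\hat J_m$ is $D$-integrable.
   Context: A metallic Riemannian manifold $(M,J,g)$ is a smooth manifold $M$ with a $(1,1)$-tensor field $J$ satisfying $J^2=pJ+qI$ and a Riemannian metric $g$ with $g(JX,Y)=g(X,JY)$ for all vector fields $X,Y$. It is locally decomposable if $\nabla^gJ=0$, where $\nabla^g$ is the Levi-Civita connection of $g$. A metallic semi-symmetric metric $J$-connection is a linear connection $D$ on $M$ such that $DJ=0$, $Dg=0$ and, for some $1$-form $\omega$ on $M$, its torsion $T^D(X,Y):=D_XY-D_YX-[X,Y]$ is $T^D(X,Y)=\omega(Y)X-\omega(X)Y+\frac1q\omega(JY)JX-\frac1q\omega(JX)JY$ for all $X,Y\in C^\infty(TM)$. $J^*:T^*M\to T^*M$ is $(J^*\alpha)(X):=\alpha(JX)$. The bracket on $C^\infty(TM\oplus T^*M)$ is $[X+\alpha,Y+\beta]_D:=[X,Y]+D_X\beta-D_Y\alpha$. An endomorphism $\hat J$ of $TM\oplus T^*M$ is $D$-integrable if $N^D_{\hat J}(\sigma,\tau):=[\hat J\sigma,\hat J\tau]_D-\hat J[\hat J\sigma,\tau]_D-\hat J[\sigma,\hat J\tau]_D+\hat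 J^2[\sigma,\tau]_D$ vanishes for all $\sigma,\tau\in C^\infty(TM\oplus T^*M)$. *)

(* Defs.v *)
From HB Require Import structures.
From mathcomp Require Import all_boot all_order all_algebra.
From mathcomp Require Import all_classical all_reals all_analysis.
Import numFieldNormedType.Exports.
Import Order.TTheory GRing.Theory Num.Theory.

Set Implicit Arguments.
Unset Strict Implicit.
Unset Printing Implicit Defensive.

Local Open Scope classical_set_scope.
Local Open Scope ring_scope.

(* Conventions.  A smooth manifold is Hausdorff, second countable, without
   boundary and of constant finite dimension.  Tensor fields are treated as in
   O'Neill's "Semi-Riemannian geometry": they are the multilinear maps over the
   ring C^oo(M) on the C^oo(M)-module of vector fields. *)

Section Smooth.
Variables (R : realType) (n : nat).
Implicit Types (U : set 'rV[R]_n) (f g : 'rV[R]_n -> R).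

(* U is meant to be open. *)
Fixpoint Ck_on (k : nat) U f : Prop :=
  (forall x, U x -> {for x, continuous f}) /\
  if k is k'.+1 then
    forall i : 'I_n, (forall x, U x -> derivable f x (delta_mx 0 i)) /\
                     Ck_on k' U ('D_(delta_mx 0 i) f)
  else True.

Definition smooth_on U f : Prop := forall k, Ck_on k U f.

Lemma Ck_onS k U f : Ck_on k.+1 U f -> Ck_on k U f.
Proof.
elim: k f => [|k IHk] f [cf df]; split=> // i; have [? ?] := df i.
by split=> //; exact: IHk.
Qed.

Lemma Ck_on_cont k U f x : Ck_on k U f -> U x -> {for x, continuous f}.
Proof. by case: k => [|k] [cf _]; exact: cf. Qed.

Lemma near_open_eq U f g x : open U -> {in U, f =1 g} -> U x ->
  \forall y \near x, f y = g y.
Proof.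
move=> oU fg Ux; near=> y; apply: fg; rewrite inE; near: y.
exact: open_nbhs_nbhs.
Unshelve. all: by end_near. Qed.

Lemma continuous_open_eq U f g : open U -> {in U, f =1 g} ->
  (forall x, U x -> {for x, continuous f}) ->
  forall x, U x -> {for x, continuous g}.
Proof.
move=> oU fg cf x Ux; have E := near_open_eq oU fg Ux.
have gx : g x = f x by rewrite fg ?inE.
rewrite /prop_for /continuous_at gx.
exact: cvg_trans (near_eq_cvg E) (cf x Ux).
Qed.

Lemma Ck_on_eq k U f g : open U -> {in U, f =1 g} -> Ck_on k U f -> Ck_on k U g.
Proof.
move=> oU; elim: k f g => [|k IHk] f g fg [cf df].
  by split=> //; exact: continuous_open_eq cf.
split=> [|i]; first exact: continuous_open_eq cf.
have [dfi Cdf] := df i.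
split=> [x Ux|].
  exact: near_eq_derivable (near_open_eq oU fg Ux) (dfi x Ux).
apply: IHk Cdf => x; rewrite inE => Ux.
exact: near_eq_derive (near_open_eq oU fg Ux).
Qed.

Lemma Ck_on_cst k U (a : R) : Ck_on k U (cst a).
Proof.
elim: k a => [|k IHk] a; (split=> [x _|]; first exact: cst_continuous) => //.
move=> i; split=> [x _|]; first exact: ex_derive.
rewrite (_ : 'D_(delta_mx 0 i) (cst a) = cst 0); first exact: IHk.
by apply/funext => x; rewrite derive_cst.
Qed.

Lemma Ck_onD k U f g : open U -> Ck_on k U f -> Ck_on k U g ->
  Ck_on k U (f + g).
Proof.
move=> oU; elim: k f g => [|k IHk] f g Cf Cg; (split=> [x Ux|];
  first by apply: continuousD; [exact: Ck_on_cont Cf _|exact: Ck_on_cont Cg _]).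
  by [].
move=> i; have [df Cdf] := Cf.2 i; have [dg Cdg] := Cg.2 i.
split=> [x Ux|]; first by apply: derivableD; [exact: df|exact: dg].
apply: Ck_on_eq oU _ (IHk _ _ Cdf Cdg) => x; rewrite inE => Ux.
by rewrite deriveD; [|exact: df|exact: dg].
Qed.

Lemma Ck_onM k U f g : open U -> Ck_on k U f -> Ck_on k U g ->
  Ck_on k U (f * g).
Proof.
move=> oU; elim: k f g => [|k IHk] f g Cf Cg; (split=> [x Ux|];
  first by apply: continuousM; [exact: Ck_on_cont Cf _|exact: Ck_on_cont Cg _]).
  by [].
move=> i; have [df Cdf] := Cf.2 i; have [dg Cdg] := Cg.2 i.
split=> [x Ux|]; first by apply: derivableM; [exact: df|exact: dg].
apply: Ck_on_eq oU _
  (Ck_onD oU (IHk _ _ (Ck_onS Cf) Cdg) (IHk _ _ (Ck_onS Cg) Cdf)).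
move=> x; rewrite inE => Ux.
by rewrite deriveM; [|exact: df|exact: dg].
Qed.

End Smooth.

Section Manifold.
Variables (R : realType) (n : nat).

(* [chart_inv] is irrelevant outside the image of [chart_dom]. *)
Record chart (M : topologicalType) := Chart {
  chart_dom : set M;
  chart_map : M -> 'rV[R]_n;
  chart_inv : 'rV[R]_n -> M;
  chart_dom_open : open chart_dom;
  chart_cod_open : open (chart_map @` chart_dom);
  chart_mapK : {in chart_dom, cancel chart_map chart_inv};
  chart_map_continuous : {within chart_dom, continuous chart_map};
  chart_inv_continuous : {within chart_map @` chart_dom, continuous chart_inv}
}.

Definition smooth_transition (M : topologicalType) (c d : chart M) : Prop :=
  forall i : 'I_n,
    smooth_on (chart_map c @` (chart_dom c `&` chart_dom d))
              (fun v => chart_map d (chart_inv c v) 0 i).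

Record smooth_manifold := SmoothManifold {
  manifold_space :> topologicalType;
  manifold_hausdorff : hausdorff_space manifold_space;
  manifold_second_countable : @second_countable manifold_space;
  manifold_atlas : set (chart manifold_space);
  manifold_cover : forall x, exists2 c, manifold_atlas c & chart_dom c x;
  manifold_compatible : forall c d,
    manifold_atlas c -> manifold_atlas d -> smooth_transition c d
}.

Definition smooth (M : smooth_manifold) : {pred M -> R} :=
  fun f => `[< forall c, manifold_atlas c ->
    smooth_on (chart_map c @` chart_dom c) (f \o chart_inv c) >].

End Manifold.

Section SmoothFunctions.
Variables (R : realType) (n : nat) (M : smooth_manifold R n).

Lemma smooth_cst (a : R) : (cst a : M -> R) \in @smooth R n M.
Proof. by apply/asboolP => c _ k; exact: Ck_on_cst. Qed.

Fact smooth_subring : subring_closed (@smooth R n M).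
Proof.
split=> [|f g /asboolP sf /asboolP sg|f g /asboolP sf /asboolP sg].
- exact: smooth_cst.
- apply/asboolP => c Ac k; rewrite -[f - g]/(f + - g) -mulN1r.
  apply: (@Ck_onD _ _ _ _ (f \o _) ((cst (-1) * g) \o _)).
  + exact: chart_cod_open.
  + exact: sf.
  + apply: (@Ck_onM _ _ _ _ (cst (-1)) (g \o _)).
    * exact: chart_cod_open.
    * exact: Ck_on_cst.
    * exact: sg.
- apply/asboolP => c Ac k.
  apply: (@Ck_onM _ _ _ _ (f \o _) (g \o _)).
  + exact: chart_cod_open.
  + exact: sf.
  + exact: sg.
Qed.
HB.instance Definition _ :=
  GRing.isSubringClosed.Build (M -> R) (@smooth R n M) smooth_subring.

Record smooth_fun := SmoothFun {
  smooth_fun_val :> M -> R;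
  smooth_funP : smooth_fun_val \in @smooth R n M }.
HB.instance Definition _ := [isSub for smooth_fun_val].
HB.instance Definition _ := [Choice of smooth_fun by <:].
HB.instance Definition _ :=
  GRing.SubChoice_isSubComPzRing.Build (M -> R) (@smooth R n M) smooth_fun
    smooth_subring.

Definition smooth_const (a : R) : smooth_fun := SmoothFun (smooth_cst a).

End SmoothFunctions.

Section VectorFields.
Variables (R : realType) (n : nat) (M : smooth_manifold R n).
Local Notation C := (smooth_fun M).

Definition derivation : {pred C -> C^o} := fun X =>
  `[< (forall (a : R) (f h : C),
         X (smooth_const M a * f + h) = smooth_const M a * X f + X h) /\
      (forall f h : C, X (f * h) = f * X h + h * X f) >].

Fact derivation_submod : submod_closed derivation.
Proof.
split=> [|u X Y /asboolP[XL XM] /asboolP[YL YM]]; apply/asboolP.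
  by split=> [a f h|f h]; rewrite -![(0 : C -> C^o) _]/(0 : C) !mulr0 addr0.
have E f : (u *: X + Y) f = u * X f + Y f :> C by [].
split=> [a f h|f h]; rewrite !E.
  by rewrite XL YL !mulrDr mulrCA addrACA.
by rewrite XM YM !mulrDr addrACA ![u * (_ * _)]mulrCA.
Qed.
HB.instance Definition _ :=
  GRing.isSubmodClosed.Build C (C -> C^o) derivation derivation_submod.

(* A tangent vector at x is a derivation of C^oo(M) at x, and a section X of TM
   is smooth when x |-> X_x f is smooth for every smooth f.  A vector field is
   encoded by its action (X f) x = X_x f on smooth functions. *)
Record vector_field := VectorField {
  vector_field_val : C -> C^o;
  vector_fieldP : vector_field_val \in derivation }.
HB.instance Definition _ := [isSub for vector_field_val].
HB.instance Definition _ := [Choice of vector_field by <:].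
HB.instance Definition _ := [SubChoice_isSubLmodule of vector_field by <:].

Definition apply_vector_field (X : vector_field) : C -> C := vector_field_val X.
Coercion apply_vector_field : vector_field >-> Funclass.

Definition value_at (X : vector_field) (x : M) : C -> R := fun f => X f x.

Lemma vector_field_linear (X : vector_field) a f h :
  X (smooth_const M a * f + h) = smooth_const M a * X f + X h.
Proof. by case: X => X /= /asboolP[XL XM]; first [exact: XL|exact: XM]. Qed.

Lemma vector_fieldM (X : vector_field) f h : X (f * h) = f * X h + h * X f.
Proof. by case: X => X /= /asboolP[XL XM]; first [exact: XL|exact: XM]. Qed.

Lemma vector_fieldD (X : vector_field) f h : X (f + h) = X f + X h.
Proof.
have := vector_field_linear X 1 f h.
by rewrite (_ : smooth_const M 1 = 1) ?mul1r //; exact: val_inj.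
Qed.

Fact lie_bracket_derivation (X Y : vector_field) :
  (fun f => X (Y f) - Y (X f) : C^o) \in derivation.
Proof.
apply/asboolP; split=> [a f h|f h].
  by rewrite !vector_field_linear mulrBr opprD addrACA.
rewrite !vector_fieldM !vector_fieldD !vector_fieldM !mulrBr.
rewrite (mulrC (Y h) (X f)) (mulrC (X h) (Y f)).
rewrite [X in X - _]addrACA [X in _ - X]addrACA [X in _ + X - _]addrC.
by rewrite [X in _ - X]addrC [X in X - _]addrC opprD addrACA subrr add0r
  opprD addrACA.
Qed.
Definition lie_bracket (X Y : vector_field) : vector_field :=
  VectorField (lie_bracket_derivation X Y).

Definition one_form_pred : {pred vector_field -> C^o} := fun a => `[< linear a >].

Fact one_form_submod : submod_closed one_form_pred.
Proof.
split=> [|u a b /asboolP La /asboolP Lb]; apply/asboolP => v X Y.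
  by rewrite -![(0 : vector_field -> C^o) _]/(0 : C^o) scaler0 addr0.
have E Z : (u *: a + b) Z = u *: a Z + b Z by [].
by rewrite !E La Lb !scalerDr !scalerA (mulrC u) addrACA.
Qed.
HB.instance Definition _ :=
  GRing.isSubmodClosed.Build C (vector_field -> C^o) one_form_pred
    one_form_submod.

Record one_form := OneForm {
  one_form_val : vector_field -> C^o;
  one_formP : one_form_val \in one_form_pred }.
HB.instance Definition _ := [isSub for one_form_val].
HB.instance Definition _ := [Choice of one_form by <:].
HB.instance Definition _ := [SubChoice_isSubLmodule of one_form by <:].

Definition apply_one_form (a : one_form) : vector_field -> C := one_form_val a.
Coercion apply_one_form : one_form >-> Funclass.

Lemma one_form_linear (a : one_form) u X Y : a (u *: X + Y) = u * a X + a Y.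
Proof. by case: a => a /= /asboolP La; exact: La. Qed.

Definition tensor11 := {linear vector_field -> vector_field}.

Fact dual_map_linear (J : tensor11) (a : one_form) :
  (fun X => a (J X) : C^o) \in one_form_pred.
Proof. by apply/asboolP => u X Y; rewrite linearP one_form_linear. Qed.
Definition dual_map (J : tensor11) (a : one_form) : one_form :=
  OneForm (dual_map_linear J a).

(* Linearity over the reals in the second argument follows from
   [connectionDr] and [connectionZr], vector fields killing constants. *)
Record connection := Connection {
  connection_map :> vector_field -> vector_field -> vector_field;
  connection_linearl : forall (f : C) X Y Z,
    connection_map (f *: X + Y) Z =
    f *: connection_map X Z + connection_map Y Z;
  connectionDr : forall X Y Z,
    connection_map X (Y + Z) = connection_map X Y + connection_map X Z;
  connectionZr : forall (f : C) X Y,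
    connection_map X (f *: Y) = X f *: Y + f *: connection_map X Y }.

Definition torsion (D : connection) (X Y : vector_field) : vector_field :=
  D X Y - D Y X - lie_bracket X Y.

Fact covariant_derivative_linear (D : connection) (X : vector_field)
    (b : one_form) :
  (fun Y => X (b Y) - b (D X Y) : C^o) \in one_form_pred.
Proof.
apply/asboolP => u Y Z.
rewrite connectionDr connectionZr -addrA !one_form_linear vector_fieldD.
rewrite vector_fieldM (mulrC (b Y)) (addrC (u * X (b Y))).
rewrite -(addrA (X u * b Y)) (opprD (X u * b Y)) (@addrACA C) subrr add0r.
rewrite (@opprD C) (@addrACA C).
by congr (_ + _); rewrite -[RHS]/(u * _) (@mulrBr C).
Qed.
(* The extension of D to T^*M : (D_X b)(Y) = X(b(Y)) - b(D_X Y). *)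
Definition covariant_derivative (D : connection) (X : vector_field)
    (b : one_form) : one_form :=
  OneForm (covariant_derivative_linear D X b).

Record metric := Metric {
  metric_form :> vector_field -> vector_field -> C;
  metric_linearl : forall (f : C) X Y Z,
    metric_form (f *: X + Y) Z = f * metric_form X Z + metric_form Y Z;
  metric_sym : forall X Y, metric_form X Y = metric_form Y X;
  metric_posdef : forall X (x : M),
    value_at X x <> (fun=> 0) -> 0 < metric_form X X x }.

Definition metric_connection (g : metric) (D : connection) : Prop :=
  forall X Y Z : vector_field, X (g Y Z) = g (D X Y) Z + g Y (D X Z).

Definition levi_civita (g : metric) (D : connection) : Prop :=
  metric_connection g D /\ forall X Y, torsion D X Y = 0.

(* D J = 0, where (D_X J) Y = D_X (J Y) - J (D_X Y). *)
Definition parallel (D : connection) (J : tensor11) : Prop :=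
  forall X Y, D X (J Y) - J (D X Y) = 0.

Definition metallic (p q : R) (J : tensor11) : Prop := forall X,
  J (J X) = smooth_const M p *: J X + smooth_const M q *: X.

Definition metallic_riemannian (p q : R) (J : tensor11) (g : metric) : Prop :=
  metallic p q J /\ forall X Y, g (J X) Y = g X (J Y).

(* The Levi-Civita connection is given through its characterization; it is
   the only connection satisfying [levi_civita g]. *)
Definition locally_decomposable (J : tensor11) (g : metric) : Prop :=
  exists2 nabla : connection, levi_civita g nabla & parallel nabla J.

Definition metallic_semi_symmetric_metric_connection
    (q : R) (J : tensor11) (g : metric) (D : connection) : Prop :=
  [/\ parallel D J, metric_connection g D &
      exists w : one_form, forall X Y,
        torsion D X Y =
          w Y *: X - w X *: Y
          + smooth_const M q^-1 *: (w (J Y) *: J X)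
          - smooth_const M q^-1 *: (w (J X) *: J Y)].

(* Sections X + a of TM (+) T^*M are the pairs (X, a). *)
Definition gen_section := (vector_field * one_form)%type.
Definition gen_endomorphism := {linear gen_section -> gen_section}.

Definition gen_bracket (D : connection) (s t : gen_section) : gen_section :=
  (lie_bracket s.1 t.1,
   covariant_derivative D s.1 t.2 - covariant_derivative D t.1 s.2).

Definition gen_nijenhuis (D : connection) (E : gen_endomorphism)
    (s t : gen_section) : gen_section :=
  gen_bracket D (E s) (E t) - E (gen_bracket D (E s) t)
  - E (gen_bracket D s (E t)) + E (E (gen_bracket D s t)).

Definition D_integrable (D : connection) (E : gen_endomorphism) : Prop :=
  forall s t, gen_nijenhuis D E s t = 0.

Definition gen_diag_map (J : tensor11) (s : gen_section) : gen_section :=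
  (J s.1, dual_map J s.2).
Fact gen_diag_linear (J : tensor11) : linear (gen_diag_map J).
Proof.
move=> u [X a] [Y b]; rewrite /gen_diag_map /= linearP.
by congr (_, _); exact: val_inj.
Qed.
HB.instance Definition _ (J : tensor11) :=
  GRing.isLinear.Build C gen_section gen_section *:%R (gen_diag_map J)
    (gen_diag_linear J).
(* The endomorphism diag(J, J^* ) of TM (+) T^*M. *)
Definition gen_diag (J : tensor11) : gen_endomorphism := gen_diag_map J.

(* gen_diag J is a generalized metallic structure. *)
Lemma gen_diag_metallic (p q : R) (J : tensor11) : metallic p q J ->
  forall s, gen_diag J (gen_diag J s) =
            smooth_const M p *: gen_diag J s + smooth_const M q *: s.
Proof.
move=> J2 [X a]; congr (_, _); first exact: J2.
apply/val_inj/funext => Y; rewrite -[LHS]/(a (J (J Y))) J2.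
rewrite one_form_linear; congr (_ + _).
have a0 : a 0 = 0.
  have := one_form_linear a 1 0 0; rewrite scaler0 mul1r addr0 => e.
  by apply: (@addrI C (a 0)); rewrite addr0.
by rewrite -[_ *: Y]addr0 one_form_linear a0 addr0.
Qed.

End VectorFields.

(* Main.v *)
Require Import Defs.
From mathcomp Require Import all_boot all_order all_algebra.
From mathcomp Require Import all_classical all_reals all_analysis.
Import Order.TTheory GRing.Theory Num.Theory.
Local Open Scope ring_scope.

(** The bracket on TM (+) T^*M uses the commutator of vector fields on TM and
    the connection D on T^*M.  Since the Levi-Civita connection nabla has no
    torsion, this bracket is the antisymmetrization of
      P_(X + a) (Y + b) = nabla_X Y + D_X b.
    The operator P_s commutes with diag(J, J^* ) for every s: on TM because
    nabla J = 0, on T^*M because D J = 0 dualizes to D J^* = 0.  The Nijenhuis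
    expression of an endomorphism commuting with all P_s cancels term by term
    ([nijenhuis_antisymmetrization]). *)

(** The algebra behind the vanishing of Nijenhuis tensors: each of the four
    brackets contributes two terms, and moving [E] out of the second argument
    of [P] makes these eight terms cancel in pairs. *)
Lemma nijenhuis_antisymmetrization (V : zmodType) (E : {additive V -> V})
    (P : V -> V -> V) :
  (forall s t, P s (E t) = E (P s t)) ->
  forall s t,
    (P (E s) (E t) - P (E t) (E s)) - E (P (E s) t - P t (E s))
    - E (P s (E t) - P (E t) s) + E (E (P s t - P t s)) = 0.
Proof.
move=> PE s t; rewrite !(raddfB E) !PE !opprB.
by rewrite [X in X + _ + _]addrC !subrKA subrr.
Qed.

Section Connections.
Context {R : realType} {n : nat} {M : smooth_manifold R n}.
Implicit Types (D : connection M) (J : tensor11 M).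

Lemma parallel_commute D J (X Y : vector_field M) :
  parallel D J -> D X (J Y) = J (D X Y).
Proof. by move=> DJ; apply/eqP; rewrite -subr_eq0 DJ. Qed.

Lemma lie_bracket_torsion_free D (X Y : vector_field M) :
  torsion D X Y = 0 -> lie_bracket X Y = D X Y - D Y X.
Proof. by move=> /eqP; rewrite subr_eq0 => /eqP. Qed.

(** Evaluated at Y, the two sides differ by b((D_X J) Y). *)
Lemma covariant_derivative_dual_map D J (X : vector_field M) (b : one_form M) :
  parallel D J ->
  covariant_derivative D X (dual_map J b) =
  dual_map J (covariant_derivative D X b).
Proof.
move=> DJ; apply/val_inj/funext => Y.
rewrite -[LHS]/(X (b (J Y)) - b (J (D X Y))).
by rewrite -[RHS]/(X (b (J Y)) - b (D X (J Y))) parallel_commute.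
Qed.

(** Two connections are allowed because the tangent part of the bracket can be
    written with any torsion-free connection, whatever the connection used on
    1-forms. *)
Definition split_derivative (nabla D : connection M) (s t : gen_section M) :
  gen_section M := (nabla s.1 t.1, covariant_derivative D s.1 t.2).

Lemma split_derivative_gen_diag (nabla D : connection M) J s t :
  parallel nabla J -> parallel D J ->
  split_derivative nabla D s (gen_diag J t) =
  gen_diag J (split_derivative nabla D s t).
Proof.
move=> nablaJ DJ; congr (_, _); first exact: parallel_commute.
exact: covariant_derivative_dual_map.
Qed.

Lemma gen_bracket_split (nabla D : connection M) (s t : gen_section M) :
  (forall X Y, torsion nabla X Y = 0) ->
  gen_bracket D s t = split_derivative nabla D s t - split_derivative nabla D t s.
Proof. by move=> T0; congr (_, _); exact: lie_bracket_torsion_free. Qed.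

End Connections.

Theorem proposition2p6 (R : realType) (n : nat) (M : smooth_manifold R n)
    (p q : R) (J : tensor11 M) (g : metric M) (D : connection M)
    (q_neq0 : q != 0)
    (J_metallic : metallic_riemannian p q J g)
    (J_decomposable : locally_decomposable J g)
    (D_semi_symmetric : metallic_semi_symmetric_metric_connection q J g D) :
  D_integrable D (gen_diag J).
Proof.
have [nabla [_ nabla_T0] nablaJ] := J_decomposable.
have [DJ _ _] := D_semi_symmetric.
move=> s t; rewrite /gen_nijenhuis !(gen_bracket_split nabla) //.
apply: nijenhuis_antisymmetrization => {}s {}t.
exact: split_derivative_gen_diag.
Qed.
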